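(* Suppose $\alpha=1$. Let $U_-=(\rho_-,u_-,v_-)$ and $U_+=(\rho_+,u_+,v_+)$ be the left and right Riemann states, $\rho_\pm>0$. If $$u_++\frac{\sqrt{A(v_+)}}{\rho_+}>u_--\frac{\sqrt{A(v_-)}}{\rho_-},$$ then the unique solution to the Riemann problem consists of three contact discontinuities. If $$u_++\frac{\sqrt{A(v_+)}}{\rho_+}\le u_--\frac{\sqrt{A(v_-)}}{\rho_-},$$ then the unique solution to the Riemann problem is the overcompressive $\delta$-shock with, for $[\rho]\neq0$, $$x(t)=\sigma_+t,\quad w(t)=t\sqrt{\Delta},\quad u_\delta=\sigma_+,\quad v_\delta=\frac{\sigma_+[\rho v]-[\rho uv]}{\sqrt\Delta},\qquad \sigma_+=\frac{[\rho u]+\sqrt\Delta}{[\rho]},\quad \Delta=[\rho u]^2-[\rho]\Big[\rho u^2-\frac{A(v)}{\rho}\Big],$$ and, for $[\rho]=0$ (with $\rho$ the common density), $$x(t)=\sigma_0t,\quad w(t)=-\rho[u]t,\quad u_\delta=\sigma_0,\quad v_\delta=v_++\frac{[v]}{[u]}(u_--\sigma_0),\qquad \sigma_0=\frac{[\rho u^2-A(v)/\rho]}{2[\rho u]}.$$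
   Context: The system is $\rho_t+(\rho u)_x=0$, $(\rho u)_t+(\rho u^2-\frac{A(v)}{\rho})_x=0$, $(\rho v)_t+(\rho uv)_x=0$ (the case $\alpha=1$), with $A$ a strictly positive continuous function, $\rho>0$, and initial data $U_-$ for $x<0$, $U_+$ for $x>0$. $[\cdot]=\cdot_+-\cdot_-$ denotes the jump. Characteristic speeds: $\lambda_1=u-\sqrt{A(v)}/\rho$, $\lambda_2=u$, $\lambda_3=u+\sqrt{A(v)}/\rho$; all three families are linearly degenerate. Solutions considered are of two kinds. (i) Self-similar solutions consisting of three contact discontinuities: piecewise constant functions of $x/t$ with states $U_-,U_{M_1},U_{M_2},U_+$, where $U_{M_1}$ lies on the 1-contact curve of $U_-$: $v=v_-$, $u=u_-+\sqrt{A(v_-)}(\frac1\rho-\frac1{\rho_-})$; $U_{M_2}$ lies on the 2-contact curve of $U_{M_1}$: $u=u_{M_1}$, $A(v)=\rho A(v_{M_1})/\rho_{M_1}$; and $U_+$ lies on the 3-contact curve of $U_{M_2}$: $v=v_{M_2}$, $u=u_{M_2}-\sqrt{A(v_{M_2})}(\frac1\rho-\frac1{\rho_{M_2}})$; densities positive, propagation speeds $\tau_1=\lambda_1(U_-)$, $\tau_2=u_{M_1}$, $\tau_3=\lambda_3(U_+)$ in increasing order. (ii) Overcompressive $\delta$-shocks: $(\rho,u,v)=U_-$ for $x<x(t)$ and $U_+$ for $x>x(t)$, with an additional measure $w(t)\delta(x-x(t))$ in $\rho$, the concentrated mass carrying velocity $u_\delta=dx/dt$ and transported state $v_\delta$,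 with $w(0)=0$, satisfying the generalized Rankine–Hugoniot conditions (equivalent to the system in the sense of distributions, the concentrated part making no contribution to the pressure) $$\frac{dw}{dt}=[\rho]u_\delta-[\rho u],\quad \frac{d(wu_\delta)}{dt}=[\rho u]u_\delta-\Big[\rho u^2-\frac{A(v)}{\rho}\Big],\quad \frac{d(wv_\delta)}{dt}=[\rho v]u_\delta-[\rho uv],$$ and whose speed $\sigma$ satisfies the overcompressibility condition $\lambda_1(U_-)\ge\sigma\ge\lambda_3(U_+)$. *)

(* Defs.v *)
From Stdlib Require Import Reals List.
From Coquelicot Require Import Coquelicot.
Local Open Scope R_scope.

Record state := State { rho : R; u : R; v : R }.

Definition momentum (U : state) : R := rho U * u U.
Definition momentum_flux (A : R -> R) (U : state) : R :=
  rho U * u U ^ 2 - A (v U) / rho U.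
Definition rho_v (U : state) : R := rho U * v U.
Definition rho_u_v (U : state) : R := rho U * u U * v U.

Definition jump (Um Up : state) (q : state -> R) : R := q Up - q Um.

Definition lambda1 (A : R -> R) (U : state) : R := u U - sqrt (A (v U)) / rho U.
Definition lambda3 (A : R -> R) (U : state) : R := u U + sqrt (A (v U)) / rho U.

(* [contactk A U0 U]: U lies on the k-contact curve of U0. *)
Definition contact1 (A : R -> R) (U0 U : state) : Prop :=
  v U = v U0 /\ u U = u U0 + sqrt (A (v U0)) * (1 / rho U - 1 / rho U0).
Definition contact2 (A : R -> R) (U0 U : state) : Prop :=
  u U = u U0 /\ A (v U) = rho U * A (v U0) / rho U0.
Definition contact3 (A : R -> R) (U0 U : state) : Prop :=
  v U = v U0 /\ u U = u U0 - sqrt (A (v U0)) * (1 / rho U - 1 / rho U0).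

(* A concentration along the curve x = position t, as functions of time t >= 0. *)
Record delta_part := DeltaPart {
  position : R -> R;      (* x(t) *)
  mass : R -> R;     (* w(t) *)
  u_delta : R -> R;
  v_delta : R -> R }.

(* [field S t x] is the regular part at time t and position x; the optional
   component is the singular part  mass(t) * Dirac(x - position(t))  of rho. *)
Record solution := Solution {
  field : R -> R -> state;
  singular : option delta_part }.

(* Values on the discontinuity lines are left free.  Taking t = 0 in the
   conditions on [field] gives the Riemann initial data. *)
Definition three_contacts (A : R -> R) (Um Up : state) (S : solution) : Prop :=
  singular S = None /\
  exists M1 M2 : state,
    let tau1 := lambda1 A Um in
    let tau2 := u M1 in
    let tau3 := lambda3 A Up in
    0 < rho M1 /\ 0 < rho M2 /\
    contact1 A Um M1 /\ contact2 A M1 M2 /\ contact3 A M2 Up /\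
    tau1 < tau2 /\ tau2 < tau3 /\
    (forall t x, 0 <= t ->
      (x < tau1 * t -> field S t x = Um) /\
      (tau1 * t < x < tau2 * t -> field S t x = M1) /\
      (tau2 * t < x < tau3 * t -> field S t x = M2) /\
      (tau3 * t < x -> field S t x = Up)).

(* f' = g on t > 0, with f continuous up to the initial time. *)
Definition evolves (f g : R -> R) : Prop :=
  filterlim f (at_right 0) (locally (f 0)) /\
  forall t, 0 < t -> is_derive f t (g t).

(* Since mass 0 = 0, the continuity contained in [evolves] says that the
   concentrated quantities w * u_delta and w * v_delta also start from 0. *)
Definition generalized_RH (A : R -> R) (Um Up : state) (D : delta_part) : Prop :=
  let J := jump Um Up in
  position D 0 = 0 /\ mass D 0 = 0 /\
  evolves (position D) (u_delta D) /\
  evolves (mass D) (fun t => J rho * u_delta D t - J momentum) /\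
  evolves (fun t => mass D t * u_delta D t)
    (fun t => J momentum * u_delta D t - J (momentum_flux A)) /\
  evolves (fun t => mass D t * v_delta D t)
    (fun t => J rho_v * u_delta D t - J rho_u_v).

Definition delta_shock (A : R -> R) (Um Up : state) (D : delta_part)
    (S : solution) : Prop :=
  singular S = Some D /\
  (forall t x, 0 <= t ->
    (x < position D t -> field S t x = Um) /\
    (position D t < x -> field S t x = Up)) /\
  generalized_RH A Um Up D.

Definition overcompressive (A : R -> R) (Um Up : state) (D : delta_part) : Prop :=
  forall t, 0 < t -> lambda3 A Up <= u_delta D t <= lambda1 A Um.

Definition overcompressive_delta_shock (A : R -> R) (Um Up : state)
    (D : delta_part) (S : solution) : Prop :=
  delta_shock A Um Up D S /\ overcompressive A Um Up D.

Definition riemann_solution (A : R -> R) (Um Up : state) (S : solution) : Prop :=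
  three_contacts A Um Up S \/
  exists D, overcompressive_delta_shock A Um Up D S.

(* u_delta and v_delta have no meaning at t = 0, where there is no mass. *)
Definition same_delta (D E : delta_part) : Prop :=
  (forall t, 0 <= t -> position D t = position E t /\ mass D t = mass E t) /\
  (forall t, 0 < t -> u_delta D t = u_delta E t /\ v_delta D t = v_delta E t).

(* Equality up to the free values at the discontinuities: at each time the
   regular parts may differ at finitely many points. *)
Definition same_solution (S T : solution) : Prop :=
  (forall t, 0 <= t ->
    exists l : list R, forall x, ~ In x l -> field S t x = field T t x) /\
  match singular S, singular T with
  | None, None => True
  | Some D, Some E => same_delta D E
  | _, _ => False
  end.

Definition unique_riemann_solution (A : R -> R) (Um Up : state) (S : solution)
    : Prop :=
  riemann_solution A Um Up S /\
  forall T, riemann_solution A Um Up T -> same_solution T S.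

Definition rh_discriminant (A : R -> R) (Um Up : state) : R :=
  jump Um Up momentum ^ 2 - jump Um Up rho * jump Um Up (momentum_flux A).

(* Main.v *)
Require Import Defs.
From Stdlib Require Import Reals List Lra.
From Coquelicot Require Import Coquelicot.
Local Open Scope R_scope.

(** Contacts. [lambda1] is constant along 1-contact curves and [lambda3] along
    3-contact curves, while a 2-contact preserves the velocity and the ratio
    [p = A v / rho]. The velocity between the outer contacts is therefore both
    [lambda1 A Um + p / sqrt (A (v Um))] and [lambda3 A Up - p / sqrt (A (v Up))].
    This linear equation has one solution [p], and [p > 0], which means positive
    densities and ordered speeds, exactly when [lambda1 A Um < lambda3 A Up]
    ([contact_states_unique], [contact_states_connect]).

    Delta-shocks. Overcompressibility requires [lambda3 A Up <= lambda1 A Um],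
    so the two kinds of solution never coexist. Integrating the generalized
    Rankine-Hugoniot conditions from time [0] turns mass and momentum into
    linear functions of the position [x] and of [t]; together with
    [u_delta = x'] they say that a quadratic form in [(x, t)] has zero
    derivative, so that [x / t] is a root of the quadratic [speed_form]
    ([overcompressive_delta_linear]). Half the derivative of [speed_form] is
    the rate at which mass concentrates, and this rate is positive on the whole
    interval [[lambda3 A Up, lambda1 A Um]] ([mass_rate_pos]); [speed_form]
    changes sign over the interval, so it has exactly one root there
    ([speed_form_root], [speed_form_root_unique]). That root is the shock
    speed, whether [speed_form] is quadratic ([[rho] <> 0]) or linear
    ([[rho] = 0]). In the quadratic case the discriminant is the square of the
    positive mass rate, which is why the root with [+ sqrt d] is the right one.
    *)

(** * Evolution from an initial value *)

Lemma evolves_plus (f g f' g' : R -> R) :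
  evolves f f' -> evolves g g' ->
  evolves (fun t => f t + g t) (fun t => f' t + g' t).
Proof.
  intros [f_right f_derive] [g_right g_derive]. split.
  - exact (filterlim_comp_2 f g Rplus f_right g_right
             (filterlim_plus (f 0) (g 0))).
  - intros t t_pos. exact (is_derive_plus f g t _ _ (f_derive t t_pos) (g_derive t t_pos)).
Qed.

Lemma evolves_mult (f g f' g' : R -> R) :
  evolves f f' -> evolves g g' ->
  evolves (fun t => f t * g t) (fun t => f' t * g t + f t * g' t).
Proof.
  intros [f_right f_derive] [g_right g_derive]. split.
  - exact (filterlim_comp_2 f g Rmult f_right g_right
             (filterlim_mult (f 0) (g 0))).
  - intros t t_pos.
    exact (is_derive_mult f g t _ _ (f_derive t t_pos) (g_derive t t_pos) Rmult_comm).
Qed.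

Lemma evolves_linear (a : R) : evolves (fun t => a * t) (fun _ => a).
Proof.
  split.
  - apply (filterlim_filter_le_1 (F := locally 0)).
    + exact (filter_le_within _).
    + apply (ex_derive_continuous (fun t => a * t)). auto_derive. exact I.
  - intros t _. auto_derive; [exact I | ring].
Qed.

Lemma evolves_const (a : R) : evolves (fun _ => a) (fun _ => 0).
Proof.
  split.
  - apply filterlim_const.
  - intros t _. exact (is_derive_const a t).
Qed.

Lemma evolves_ext (f g f' g' : R -> R) :
  (forall t, f t = g t) -> (forall t, 0 < t -> f' t = g' t) ->
  evolves f f' -> evolves g g'.
Proof.
  intros fg fg' [f_right f_derive]. split.
  - rewrite <- fg. exact (filterlim_ext f g fg f_right).
  - intros t t_pos. rewrite <- fg' by assumption.
    exact (is_derive_ext f g t _ fg (f_derive t t_pos)).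
Qed.

(** The mean value theorem applies on [[s, t]] with [0 < s]; right continuity
    at [0] carries the resulting inequality to the limit [s -> 0]. *)
Lemma evolves_nonneg (f f' : R -> R) :
  evolves f f' -> (forall t, 0 < t -> 0 <= f' t) ->
  forall t, 0 <= t -> f 0 <= f t.
Proof.
  intros [f_right f_derive] f'_nonneg t [t_pos | <-]; [| lra].
  assert (f_incr : forall s, 0 < s < t -> f s <= f t).
  { intros s s_t.
    destruct (MVT_gen f s t f') as [r [r_between f_eq]].
    - intros r Hr. apply f_derive. rewrite Rmin_left in Hr; lra.
    - intros r Hr. apply derivable_continuous_pt. exists (f' r).
      apply is_derive_Reals, f_derive. rewrite Rmin_left in Hr; lra.
    - rewrite Rmin_left, Rmax_right in r_between by lra.
      assert (0 <= f' r) by (apply f'_nonneg; lra). nra. }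
  apply (filterlim_le (F := at_right 0) f (fun _ => f t) (f 0) (f t)).
  - exists (mkposreal t t_pos). intros s s_near s_pos. apply f_incr.
    apply Rabs_lt_between' in s_near. simpl in s_near. lra.
  - exact f_right.
  - apply filterlim_const.
Qed.

Lemma evolves_ge (f f' : R -> R) (a : R) :
  evolves f f' -> f 0 = 0 -> (forall t, 0 < t -> a <= f' t) ->
  forall t, 0 <= t -> a * t <= f t.
Proof.
  intros f_ev f_0 f'_ge t t_nonneg.
  assert (ineq := evolves_nonneg _ _ (evolves_plus _ _ _ _ f_ev (evolves_linear (- a)))).
  simpl in ineq. specialize (ineq (fun s s_pos => ltac:(specialize (f'_ge s s_pos); lra)) t t_nonneg).
  lra.
Qed.

Lemma evolves_le (f f' : R -> R) (a : R) :
  evolves f f' -> f 0 = 0 -> (forall t, 0 < t -> f' t <= a) ->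
  forall t, 0 <= t -> f t <= a * t.
Proof.
  intros f_ev f_0 f'_le t t_nonneg.
  assert (opp_ev : evolves (fun s => - f s) (fun s => - f' s)).
  { eapply evolves_ext; [| | exact (evolves_mult _ _ _ _ (evolves_const (-1)) f_ev)];
      intros; simpl; ring. }
  assert (- a * t <= - f t); [| lra].
  apply (evolves_ge _ _ (- a) opp_ev); [lra | | assumption].
  intros s s_pos. specialize (f'_le s s_pos). lra.
Qed.

Lemma evolves_unique (f g h : R -> R) :
  evolves f h -> evolves g h -> f 0 = g 0 -> forall t, 0 <= t -> f t = g t.
Proof.
  intros f_ev g_ev eq_0 t t_nonneg.
  assert (diff_ev : evolves (fun s => f s + -1 * g s) (fun _ => 0)).
  { eapply evolves_ext;
      [| | exact (evolves_plus _ _ _ _ f_ev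
                    (evolves_mult _ _ _ _ (evolves_const (-1)) g_ev))];
      intros; simpl; ring. }
  assert (diff_0 : f 0 + -1 * g 0 = 0) by lra.
  assert (lower := evolves_ge _ _ 0 diff_ev diff_0 (fun _ _ => Rle_refl 0) t t_nonneg).
  assert (upper := evolves_le _ _ 0 diff_ev diff_0 (fun _ _ => Rle_refl 0) t t_nonneg).
  simpl in lower, upper. lra.
Qed.

Lemma evolves_combination (x x' : R -> R) (a b : R) :
  evolves x x' ->
  evolves (fun t => a * x t - b * t) (fun t => a * x' t - b).
Proof.
  intros x_ev.
  eapply evolves_ext;
    [| | exact (evolves_plus _ _ _ _ (evolves_mult _ _ _ _ (evolves_const a) x_ev)
                  (evolves_linear (- b)))];
    intros; simpl; ring.
Qed.

(** * Three contact discontinuities *)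

Lemma sqrt_A_pos (A : R -> R) (A_pos : forall s, 0 < A s) (s : R) : 0 < sqrt (A s).
Proof. apply sqrt_lt_R0, A_pos. Qed.

(** The value of [A v / rho] shared by the two intermediate states. *)
Definition contact_pressure (A : R -> R) (Um Up : state) : R :=
  (lambda3 A Up - lambda1 A Um) / (/ sqrt (A (v Um)) + / sqrt (A (v Up))).

Definition contact_state1 (A : R -> R) (Um Up : state) : state :=
  State (A (v Um) / contact_pressure A Um Up)
    (lambda1 A Um + contact_pressure A Um Up / sqrt (A (v Um))) (v Um).

Definition contact_state2 (A : R -> R) (Um Up : state) : state :=
  State (A (v Up) / contact_pressure A Um Up)
    (lambda1 A Um + contact_pressure A Um Up / sqrt (A (v Um))) (v Up).

(** Subtracting the two expressions of the intermediate velocity in terms of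
    [p = A v / rho] gives
    [lambda3 A Up - lambda1 A Um = p * (/ sqrt (A (v Um)) + / sqrt (A (v Up)))].
    Positive densities make [p] positive, hence the order of the outer speeds,
    and [p] determines both states. *)
Lemma contact_states_unique (A : R -> R) (A_pos : forall s, 0 < A s)
    (Um Up M1 M2 : state) :
  0 < rho M1 -> 0 < rho M2 ->
  contact1 A Um M1 -> contact2 A M1 M2 -> contact3 A M2 Up ->
  lambda1 A Um < lambda3 A Up /\
  M1 = contact_state1 A Um Up /\ M2 = contact_state2 A Um Up.
Proof.
  intros rho1 rho2 [v1 u1] [u2 p2] [v2 up].
  destruct M1 as [r1 w1 z1], M2 as [r2 w2 z2]. simpl in *. subst z1 w2.
  rewrite <- v2 in up, p2.
  assert (am := sqrt_A_pos A A_pos (v Um)).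
  assert (ap := sqrt_A_pos A A_pos (v Up)).
  assert (sq_m : A (v Um) = sqrt (A (v Um)) * sqrt (A (v Um)))
    by (symmetry; apply sqrt_sqrt, Rlt_le, A_pos).
  assert (sq_p : A (v Up) = sqrt (A (v Up)) * sqrt (A (v Up)))
    by (symmetry; apply sqrt_sqrt, Rlt_le, A_pos).
  set (a := sqrt (A (v Um))) in *. set (b := sqrt (A (v Up))) in *.
  set (p := A (v Um) / r1).
  assert (p_pos : 0 < p) by (apply Rdiv_lt_0_compat; auto).
  assert (p_m : p = a * a / r1) by (unfold p; rewrite sq_m at 1; reflexivity).
  assert (p_p : p = b * b / r2).
  { unfold p. rewrite <- sq_p, p2. field; lra. }
  assert (speed1 : w1 = lambda1 A Um + p / a).
  { unfold lambda1. fold a. rewrite p_m, u1. unfold Rdiv.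
    replace (a * a * / r1 * / a) with (a * / r1) by (field; lra). ring. }
  assert (speed3 : lambda3 A Up = w1 + p / b).
  { unfold lambda3. fold b. rewrite p_p, up. unfold Rdiv.
    replace (b * b * / r2 * / b) with (b * / r2) by (field; lra). ring. }
  assert (ia : 0 < / a) by (apply Rinv_0_lt_compat; assumption).
  assert (ib : 0 < / b) by (apply Rinv_0_lt_compat; assumption).
  assert (gap : lambda3 A Up - lambda1 A Um = p * (/ a + / b))
    by (rewrite speed3, speed1; unfold Rdiv; ring).
  assert (p_eq : contact_pressure A Um Up = p).
  { unfold contact_pressure. fold a b. rewrite gap. field. split; [lra|split;[lra|lra]]. }
  split; [nra |].
  unfold contact_state1, contact_state2. fold a. rewrite p_eq. split.
  - rewrite <- speed1. f_equal. rewrite p_m, sq_m. fold a. field. split; lra.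
  - rewrite <- speed1. f_equal; [| congruence]. rewrite p_p, sq_p. field. split; lra.
Qed.

Lemma contact_pressure_pos (A : R -> R) (A_pos : forall s, 0 < A s) (Um Up : state) :
  lambda1 A Um < lambda3 A Up -> 0 < contact_pressure A Um Up.
Proof.
  intros gap. apply Rdiv_lt_0_compat; [lra |].
  apply Rplus_lt_0_compat; apply Rinv_0_lt_compat, sqrt_A_pos, A_pos.
Qed.

Lemma contact_states_connect (A : R -> R) (A_pos : forall s, 0 < A s) (Um Up : state) :
  0 < rho Um -> 0 < rho Up -> lambda1 A Um < lambda3 A Up ->
  let M1 := contact_state1 A Um Up in
  let M2 := contact_state2 A Um Up in
  0 < rho M1 /\ 0 < rho M2 /\
  contact1 A Um M1 /\ contact2 A M1 M2 /\ contact3 A M2 Up /\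
  lambda1 A Um < u M1 /\ u M1 < lambda3 A Up.
Proof.
  intros rho_m rho_p gap. cbv zeta.
  assert (p_pos := contact_pressure_pos A A_pos Um Up gap).
  assert (am := sqrt_A_pos A A_pos (v Um)).
  assert (ap := sqrt_A_pos A A_pos (v Up)).
  assert (inv_density : forall z p, 0 < p ->
            sqrt (A z) * (1 / (A z / p)) = p / sqrt (A z)).
  { intros z p p_pos'. assert (az := sqrt_A_pos A A_pos z).
    rewrite <- (sqrt_sqrt (A z)) at 2 by (apply Rlt_le, A_pos). field. lra. }
  assert (speed3 : lambda3 A Up
            = lambda1 A Um + contact_pressure A Um Up / sqrt (A (v Um))
              + contact_pressure A Um Up / sqrt (A (v Up))).
  { unfold contact_pressure. field. lra. }
  assert (Hm := A_pos (v Um)). assert (Hp := A_pos (v Up)).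
  assert (step_m : 0 < contact_pressure A Um Up / sqrt (A (v Um)))
    by (apply Rdiv_lt_0_compat; assumption).
  assert (step_p : 0 < contact_pressure A Um Up / sqrt (A (v Up)))
    by (apply Rdiv_lt_0_compat; assumption).
  unfold contact_state1, contact_state2, contact1, contact2, contact3; simpl.
  repeat apply conj; try reflexivity; try lra;
    try (apply Rdiv_lt_0_compat; assumption).
  - unfold lambda1. rewrite Rmult_minus_distr_l, inv_density by assumption.
    unfold Rdiv. ring.
  - field. lra.
  - unfold lambda3 in speed3.
    rewrite Rmult_minus_distr_l, inv_density by assumption. unfold Rdiv in *. lra.
Qed.

Definition contact_fan (A : R -> R) (Um Up : state) : solution :=
  Solution
    (fun t x =>
       if Rlt_dec x (lambda1 A Um * t) then Um
       else if Rlt_dec x (u (contact_state1 A Um Up) * t) then contact_state1 A Um Up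
       else if Rlt_dec x (lambda3 A Up * t) then contact_state2 A Um Up
       else Up)
    None.

Lemma contact_fan_three_contacts (A : R -> R) (A_pos : forall s, 0 < A s)
    (Um Up : state) :
  0 < rho Um -> 0 < rho Up -> lambda1 A Um < lambda3 A Up ->
  three_contacts A Um Up (contact_fan A Um Up).
Proof.
  intros rho_m rho_p gap. split; [reflexivity |].
  exists (contact_state1 A Um Up), (contact_state2 A Um Up).
  destruct (contact_states_connect A A_pos Um Up rho_m rho_p gap)
    as (r1 & r2 & c1 & c2 & c3 & s12 & s23).
  cbv zeta. do 7 (split; [assumption |]).
  intros t x t_nonneg.
  assert (lambda1 A Um * t <= u (contact_state1 A Um Up) * t)
    by (apply Rmult_le_compat_r; lra).
  assert (u (contact_state1 A Um Up) * t <= lambda3 A Up * t)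
    by (apply Rmult_le_compat_r; lra).
  unfold contact_fan, field.
  repeat split; intros; repeat destruct Rlt_dec; try reflexivity; lra.
Qed.

Lemma three_contacts_unique (A : R -> R) (A_pos : forall s, 0 < A s)
    (Um Up : state) (S T : solution) :
  three_contacts A Um Up S -> three_contacts A Um Up T -> same_solution S T.
Proof.
  intros [S_regular (M1 & M2 & r1 & r2 & c1 & c2 & c3 & _ & _ & S_field)]
    [T_regular (N1 & N2 & q1 & q2 & d1 & d2 & d3 & _ & _ & T_field)].
  destruct (contact_states_unique A A_pos Um Up M1 M2 r1 r2 c1 c2 c3)
    as (_ & -> & ->).
  destruct (contact_states_unique A A_pos Um Up N1 N2 q1 q2 d1 d2 d3)
    as (_ & -> & ->).
  split; [| rewrite S_regular, T_regular; exact I].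
  intros t t_nonneg.
  exists (lambda1 A Um * t :: u (contact_state1 A Um Up) * t
            :: lambda3 A Up * t :: nil).
  intros x off_lines. simpl in off_lines.
  destruct (S_field t x t_nonneg) as (S1 & S2 & S3 & S4).
  destruct (T_field t x t_nonneg) as (T1 & T2 & T3 & T4).
  destruct (Rtotal_order x (lambda1 A Um * t)) as [? | [? | ?]];
    [rewrite S1, T1 by lra; reflexivity | exfalso; auto |].
  destruct (Rtotal_order x (u (contact_state1 A Um Up) * t)) as [? | [? | ?]];
    [rewrite S2, T2 by lra; reflexivity | exfalso; auto |].
  destruct (Rtotal_order x (lambda3 A Up * t)) as [? | [? | ?]];
    [rewrite S3, T3 by lra; reflexivity | exfalso; auto 6 |].
  rewrite S4, T4 by lra; reflexivity.
Qed.

(** * The speed of an overcompressive delta-shock *)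

(** At constant speed [s] the mass condition gives [w = t * ([rho] s - [rho u])],
    and the momentum condition fails by exactly this quantity. *)
Definition speed_form (A : R -> R) (Um Up : state) (s : R) : R :=
  jump Um Up rho * s ^ 2 - 2 * jump Um Up momentum * s + jump Um Up (momentum_flux A).

Definition mass_rate (Um Up : state) (s : R) : R :=
  jump Um Up rho * s - jump Um Up momentum.

(** The rate is [rho_+ (s - u_+) + rho_- (u_- - s)], and overcompressibility
    bounds the two terms below by [sqrt (A v_+)] and [sqrt (A v_-)]. *)
Lemma mass_rate_pos (A : R -> R) (A_pos : forall s, 0 < A s) (Um Up : state) (s : R) :
  0 < rho Um -> 0 < rho Up -> lambda3 A Up <= s <= lambda1 A Um ->
  0 < mass_rate Um Up s.
Proof.
  unfold lambda1, lambda3. intros rho_m rho_p [above below].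
  assert (am := sqrt_A_pos A A_pos (v Um)).
  assert (ap := sqrt_A_pos A A_pos (v Up)).
  assert (0 < sqrt (A (v Um)) / rho Um) by (apply Rdiv_lt_0_compat; assumption).
  assert (0 < sqrt (A (v Up)) / rho Up) by (apply Rdiv_lt_0_compat; assumption).
  unfold mass_rate, jump, momentum.
  assert (0 < rho Up * (s - u Up)) by (apply Rmult_lt_0_compat; lra).
  assert (0 < rho Um * (u Um - s)) by (apply Rmult_lt_0_compat; lra).
  lra.
Qed.

(** With [c = sqrt (A v) / rho] on each side, completing the squares gives
    [speed_form s = rho_+ ((s - u_+)^2 - c_+^2) - rho_- ((u_- - s)^2 - c_-^2)].
    The first bracket vanishes at [lambda3 A Up = u_+ + c_+], the second at
    [lambda1 A Um = u_- - c_-], and both are nonnegative between these speeds: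
    the form is nonpositive at the former and nonnegative at the latter. *)
Lemma speed_form_root (A : R -> R) (A_pos : forall s, 0 < A s) (Um Up : state) :
  0 < rho Um -> 0 < rho Up -> lambda3 A Up <= lambda1 A Um ->
  exists s, lambda3 A Up <= s <= lambda1 A Um /\ speed_form A Um Up s = 0.
Proof.
  intros rho_m rho_p order.
  set (cm := sqrt (A (v Um)) / rho Um). set (cp := sqrt (A (v Up)) / rho Up).
  assert (cm_pos : 0 < cm) by (apply Rdiv_lt_0_compat; [apply sqrt_A_pos |]; assumption).
  assert (cp_pos : 0 < cp) by (apply Rdiv_lt_0_compat; [apply sqrt_A_pos |]; assumption).
  assert (sq_m : A (v Um) / rho Um = rho Um * (cm * cm)).
  { rewrite <- (sqrt_sqrt (A (v Um))) at 1 by (apply Rlt_le, A_pos).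
    unfold cm. field. lra. }
  assert (sq_p : A (v Up) / rho Up = rho Up * (cp * cp)).
  { rewrite <- (sqrt_sqrt (A (v Up))) at 1 by (apply Rlt_le, A_pos).
    unfold cp. field. lra. }
  assert (l1 : lambda1 A Um = u Um - cm) by reflexivity.
  assert (l3 : lambda3 A Up = u Up + cp) by reflexivity.
  assert (squares : forall s, speed_form A Um Up s
            = rho Up * ((s - u Up - cp) * (s - u Up + cp))
              - rho Um * ((u Um - s - cm) * (u Um - s + cm))).
  { intros s. unfold speed_form, jump, momentum, momentum_flux.
    rewrite sq_m, sq_p. ring. }
  assert (neg : speed_form A Um Up (lambda3 A Up) <= 0).
  { rewrite squares.
    assert (0 <= rho Um * ((u Um - lambda3 A Up - cm) * (u Um - lambda3 A Up + cm)))
      by (apply Rmult_le_pos; [lra | apply Rmult_le_pos; lra]).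
    replace (lambda3 A Up - u Up - cp) with 0 by lra. lra. }
  assert (pos : 0 <= speed_form A Um Up (lambda1 A Um)).
  { rewrite squares.
    assert (0 <= rho Up * ((lambda1 A Um - u Up - cp) * (lambda1 A Um - u Up + cp)))
      by (apply Rmult_le_pos; [lra | apply Rmult_le_pos; lra]).
    replace (u Um - lambda1 A Um - cm) with 0 by lra. lra. }
  destruct (IVT_gen (speed_form A Um Up) (lambda3 A Up) (lambda1 A Um) 0)
    as (s & s_between & root).
  - intros s. apply continuity_pt_filterlim, (ex_derive_continuous (speed_form A Um Up)).
    unfold speed_form. auto_derive. exact I.
  - rewrite Rmin_left, Rmax_right; lra.
  - exists s. rewrite Rmin_left, Rmax_right in s_between by assumption. auto.
Qed.

(** The difference of the values at [r] and [s] is [r - s] times the sum of the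
    two mass rates, which is positive. *)
Lemma speed_form_root_unique (A : R -> R) (A_pos : forall s, 0 < A s)
    (Um Up : state) (r s : R) :
  0 < rho Um -> 0 < rho Up ->
  lambda3 A Up <= r <= lambda1 A Um -> lambda3 A Up <= s <= lambda1 A Um ->
  speed_form A Um Up r = 0 -> speed_form A Um Up s = 0 -> r = s.
Proof.
  intros rho_m rho_p r_range s_range r_root s_root.
  assert (r_rate := mass_rate_pos A A_pos Um Up r rho_m rho_p r_range).
  assert (s_rate := mass_rate_pos A A_pos Um Up s rho_m rho_p s_range).
  assert (factor : (r - s) * (mass_rate Um Up r + mass_rate Um Up s) = 0).
  { transitivity (speed_form A Um Up r - speed_form A Um Up s); [| lra].
    unfold speed_form, mass_rate. ring. }
  apply Rmult_integral in factor. lra.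
Qed.

(** * The overcompressive delta-shock *)

Definition linear_delta (Um Up : state) (s : R) : delta_part :=
  DeltaPart (fun t => s * t) (fun t => mass_rate Um Up s * t) (fun _ => s)
    (fun _ => (jump Um Up rho_v * s - jump Um Up rho_u_v) / mass_rate Um Up s).

Definition delta_solution (Um Up : state) (s : R) : solution :=
  Solution (fun t x => if Rlt_dec x (s * t) then Um else Up)
    (Some (linear_delta Um Up s)).

Lemma delta_solution_overcompressive (A : R -> R) (A_pos : forall s, 0 < A s)
    (Um Up : state) (s : R) :
  0 < rho Um -> 0 < rho Up ->
  lambda3 A Up <= s <= lambda1 A Um -> speed_form A Um Up s = 0 ->
  overcompressive_delta_shock A Um Up (linear_delta Um Up s) (delta_solution Um Up s).
Proof.
  intros rho_m rho_p range root.
  assert (rate := mass_rate_pos A A_pos Um Up s rho_m rho_p range).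
  split; [| intros t _; exact range].
  split; [reflexivity |]. split.
  - intros t x _. simpl.
    split; intros; destruct Rlt_dec; try reflexivity; lra.
  - unfold generalized_RH. simpl. split; [ring |]. split; [ring |].
    split; [apply evolves_linear |]. split; [apply evolves_linear |].
    split.
    + eapply evolves_ext; [| | exact (evolves_linear (mass_rate Um Up s * s))];
        intros; simpl; [ring |].
      transitivity (mass_rate Um Up s * s - speed_form A Um Up s);
        [rewrite root; ring | unfold mass_rate, speed_form; ring].
    + eapply evolves_ext;
        [| | exact (evolves_linear (jump Um Up rho_v * s - jump Um Up rho_u_v))];
        intros; simpl; [field; lra | ring].
Qed.

(** Write [F] for the momentum flux. Integrating the conditions, [w = [rho] x - [rho u] t] and
    [w u_delta = [rho u] x - [F] t]. Since [u_delta = x'], the quadratic form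
    [[rho] x^2 - 2 [rho u] x t + [F] t^2] has derivative
    [2 (w x' - ([rho u] x - [F] t)) = 0], so [x / t] is a root of [speed_form];
    it lies between [lambda3 A Up] and [lambda1 A Um] because [x'] does. *)
Lemma overcompressive_delta_linear (A : R -> R) (A_pos : forall s, 0 < A s)
    (Um Up : state) (s : R) (D : delta_part) :
  0 < rho Um -> 0 < rho Up ->
  lambda3 A Up <= s <= lambda1 A Um -> speed_form A Um Up s = 0 ->
  generalized_RH A Um Up D -> overcompressive A Um Up D ->
  same_delta D (linear_delta Um Up s).
Proof.
  intros rho_m rho_p range root RH over.
  assert (rate := mass_rate_pos A A_pos Um Up s rho_m rho_p range).
  destruct RH as (x_0 & w_0 & x_ev & w_ev & wu_ev & wv_ev).
  assert (w_eq : forall t, 0 <= t ->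
            mass D t = jump Um Up rho * position D t - jump Um Up momentum * t).
  { apply (evolves_unique _ _ _ w_ev (evolves_combination _ _ _ _ x_ev)).
    rewrite w_0, x_0. ring. }
  assert (wu_eq : forall t, 0 <= t -> mass D t * u_delta D t
            = jump Um Up momentum * position D t - jump Um Up (momentum_flux A) * t).
  { apply (evolves_unique _ _ _ wu_ev (evolves_combination _ _ _ _ x_ev)).
    rewrite w_0, x_0. ring. }
  assert (wv_eq : forall t, 0 <= t -> mass D t * v_delta D t
            = jump Um Up rho_v * position D t - jump Um Up rho_u_v * t).
  { apply (evolves_unique _ _ _ wv_ev (evolves_combination _ _ _ _ x_ev)).
    rewrite w_0, x_0. ring. }
  assert (form_zero : forall t, 0 <= t ->
            (jump Um Up rho * position D t - 2 * jump Um Up momentum * t) * position D t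
            + (jump Um Up (momentum_flux A) * t) * t = 0).
  { refine (evolves_unique _ _ (fun _ => 0) _ (evolves_const 0) _);
      [| rewrite x_0; ring].
    eapply evolves_ext;
      [| | exact (evolves_plus _ _ _ _
                    (evolves_mult _ _ _ _
                       (evolves_combination _ _ (jump Um Up rho) (2 * jump Um Up momentum) x_ev)
                       x_ev)
                    (evolves_mult _ _ _ _
                       (evolves_linear (jump Um Up (momentum_flux A)))
                       (evolves_linear 1)))];
      intros t; [simpl; ring |].
    intros t_pos. simpl.
    assert (wu := wu_eq t (Rlt_le _ _ t_pos)).
    rewrite w_eq in wu by lra.
    lra. }
  assert (x_eq : forall t, 0 <= t -> position D t = s * t).
  { intros t [t_pos | <-]; [| rewrite x_0; ring].
    assert (lower := evolves_ge _ _ (lambda3 A Up) x_ev x_0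
                       (fun r r_pos => proj1 (over r r_pos)) t (Rlt_le _ _ t_pos)).
    assert (upper := evolves_le _ _ (lambda1 A Um) x_ev x_0
                       (fun r r_pos => proj2 (over r r_pos)) t (Rlt_le _ _ t_pos)).
    replace (position D t) with (position D t / t * t) by (field; lra).
    f_equal.
    apply (speed_form_root_unique A A_pos Um Up); try assumption.
    - split; apply Rmult_le_reg_r with t; try assumption;
        replace (position D t / t * t) with (position D t) by (field; lra); assumption.
    - unfold speed_form.
      replace 0 with (0 / (t * t)) by (field; lra).
      rewrite <- (form_zero t (Rlt_le _ _ t_pos)). field. lra. }
  assert (w_lin : forall t, 0 <= t -> mass D t = mass_rate Um Up s * t).
  { intros t t_nonneg. rewrite w_eq, x_eq by assumption. unfold mass_rate. ring. }
  split; [intros t t_nonneg; split; simpl; auto |].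
  intros t t_pos.
  assert (t_nonneg := Rlt_le _ _ t_pos).
  assert (w_pos : 0 < mass D t)
    by (rewrite w_lin by assumption; apply Rmult_lt_0_compat; assumption).
  simpl. split; apply Rmult_eq_reg_l with (mass D t); try lra.
  - rewrite wu_eq, x_eq, w_lin by assumption.
    transitivity ((mass_rate Um Up s * s - speed_form A Um Up s) * t);
      [unfold mass_rate, speed_form; ring | rewrite root; ring].
  - rewrite wv_eq, x_eq, w_lin by assumption. field. lra.
Qed.

(** * Explicit formulas for the delta-shock *)

Lemma mass_rate_discriminant (A : R -> R) (Um Up : state) (s : R) :
  speed_form A Um Up s = 0 -> rh_discriminant A Um Up = mass_rate Um Up s ^ 2.
Proof.
  intros root.
  transitivity (mass_rate Um Up s ^ 2 - jump Um Up rho * speed_form A Um Up s).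
  - unfold rh_discriminant, mass_rate, speed_form. ring.
  - rewrite root. ring.
Qed.

Theorem theorem1 (A : R -> R) (A_pos : forall s : R, 0 < A s)
    (A_cont : forall s : R, continuous A s)
    (Um Up : state) (rho_m : 0 < rho Um) (rho_p : 0 < rho Up) :
  (u Up + sqrt (A (v Up)) / rho Up > u Um - sqrt (A (v Um)) / rho Um ->
   exists S : solution,
     three_contacts A Um Up S /\ unique_riemann_solution A Um Up S) /\
  (u Up + sqrt (A (v Up)) / rho Up <= u Um - sqrt (A (v Um)) / rho Um ->
   exists (S : solution) (D : delta_part),
     overcompressive_delta_shock A Um Up D S /\
     unique_riemann_solution A Um Up S /\
     (jump Um Up rho <> 0 ->
      let d := rh_discriminant A Um Up in
      let sigma := (jump Um Up momentum + sqrt d) / jump Um Up rho in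
      0 < d /\
      forall t, 0 <= t ->
        position D t = sigma * t /\
        mass D t = t * sqrt d /\
        u_delta D t = sigma /\
        v_delta D t = (sigma * jump Um Up rho_v - jump Um Up rho_u_v) / sqrt d) /\
     (jump Um Up rho = 0 ->
      let sigma := jump Um Up (momentum_flux A) / (2 * jump Um Up momentum) in
      jump Um Up momentum <> 0 /\ jump Um Up u <> 0 /\
      forall t, 0 <= t ->
        position D t = sigma * t /\
        mass D t = - rho Up * jump Um Up u * t /\
        u_delta D t = sigma /\
        v_delta D t = v Up + jump Um Up v / jump Um Up u * (u Um - sigma))).
Proof.
  change (u Up + sqrt (A (v Up)) / rho Up) with (lambda3 A Up).
  change (u Um - sqrt (A (v Um)) / rho Um) with (lambda1 A Um).
  split.
  - intros gap. exists (contact_fan A Um Up).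
    assert (fan := contact_fan_three_contacts A A_pos Um Up rho_m rho_p gap).
    split; [exact fan |]. split; [left; exact fan |].
    intros T [T_contacts | (D & _ & over)].
    + exact (three_contacts_unique A A_pos Um Up T _ T_contacts fan).
    + specialize (over 1 Rlt_0_1). lra.
  - intros order.
    destruct (speed_form_root A A_pos Um Up rho_m rho_p order) as (s & range & root).
    assert (rate := mass_rate_pos A A_pos Um Up s rho_m rho_p range).
    assert (shock := delta_solution_overcompressive A A_pos Um Up s rho_m rho_p range root).
    exists (delta_solution Um Up s), (linear_delta Um Up s).
    split; [exact shock |]. split; [| split].
    + split; [right; exists (linear_delta Um Up s); exact shock |].
      intros T [[_ (M1 & M2 & r1 & r2 & c1 & c2 & c3 & _)]
               | (D & (T_singular & T_field & RH) & over)].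
      * destruct (contact_states_unique A A_pos Um Up M1 M2 r1 r2 c1 c2 c3) as [gap _].
        lra.
      * assert (same := overcompressive_delta_linear A A_pos Um Up s D rho_m rho_p
                          range root RH over).
        split; [| rewrite T_singular; exact same].
        intros t t_nonneg. exists (s * t :: nil). intros x off_shock.
        destruct (T_field t x t_nonneg) as [T_left T_right].
        rewrite (proj1 (proj1 same t t_nonneg)) in T_left, T_right.
        simpl in *.
        destruct Rlt_dec; [apply T_left; assumption | apply T_right].
        destruct (Rtotal_order x (s * t)) as [? | [? | ?]]; [lra | | lra].
        exfalso; auto.
    + intros rho_jump. cbv zeta.
      rewrite (mass_rate_discriminant A Um Up s root).
      rewrite sqrt_pow2 by lra.
      assert (speed : (jump Um Up momentum + mass_rate Um Up s) / jump Um Up rho = s)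
        by (unfold mass_rate; field; assumption).
      rewrite speed.
      split; [apply pow_lt; assumption |].
      intros t _. simpl.
      repeat split; try ring. f_equal. ring.
    + intros rho_jump. cbv zeta.
      assert (rate_eq : mass_rate Um Up s = - jump Um Up momentum)
        by (unfold mass_rate; rewrite rho_jump; ring).
      assert (rho_eq : rho Um = rho Up) by (unfold jump in rho_jump; lra).
      assert (momentum_eq : jump Um Up momentum = rho Up * jump Um Up u)
        by (unfold jump, momentum; rewrite rho_eq; ring).
      assert (momentum_jump : jump Um Up momentum <> 0) by lra.
      assert (u_jump : jump Um Up u <> 0)
        by (intros eq; rewrite eq in momentum_eq; lra).
      assert (speed : jump Um Up (momentum_flux A) / (2 * jump Um Up momentum) = s).
      { unfold speed_form in root. rewrite rho_jump in root.
        replace (jump Um Up (momentum_flux A)) with (2 * jump Um Up momentum * s) by lra.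
        field. assumption. }
      rewrite speed.
      split; [assumption |]. split; [assumption |].
      intros t _. simpl. rewrite rate_eq, momentum_eq.
      repeat split; try ring.
      unfold jump, rho_v, rho_u_v in *. rewrite rho_eq. field. lra.
Qed.
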